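(* Let $u,v\in\mathbb{R}^m$ be strictly positive vectors and let $P\in\mathbb{R}^{m\times m}$ be a stochastic reversible matrix with stationary distribution $\mu_P$. Define the Tilted matrices $V=D^{-1}(Pv)\,P\,D(v)$ and $U=D^{-1}(Pu)\,P\,D(u)$, which are reversible. Then the stochastic matrix $W=UV$ is also reversible, and its stationary distribution $\mu_W$ satisfies $$\mu_W = \alpha\cdot Pu\circ\mu_P\circ v,\qquad \alpha=\left(\mathbf{1}^\top D(Pu)D(\mu_P)D(v)\mathbf{1}\right)^{-1}.$$ Moreover, $W$ is similar to a positive semi-definite matrix; subsequently, all of its eigenvalues are real and positive.
   Context: For a vector $x$, $D(x)$ is the diagonal matrix with $x$ on its diagonal and $D^{-1}(x)=(D(x))^{-1}$. $\circ$ is the entrywise (Hadamard) product and $\mathbf{1}$ the all-ones vector. A square matrix is stochastic if its entries are non-negative and each row sums to $1$. A stochastic matrix $P$ with stationary distribution $\mu_P$ (a probability vector with $\mu_P^\top P=\mu_P^\top$, with $D(\mu_P)$ invertible) is called reversible if $P=D^{-1}(\mu_P)P^\top D(\mu_P)$. For a strictly positive vector $u$ and a non-negative matrix $A$ with at least one non-zero entry in every row, the $u$-Tilted matrix of $A$ is $D^{-1}(Au)\,A\,D(u)$.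
   Formalization: ''Real and positive'' eigenvalues is proved as real and non-negative: strict positivity fails, e.g. for m = 2, P with all entries 1/2 and u = v = 1, where W = P has eigenvalue 0. *)

(* Defs.v *)
From HB Require Import structures.
From mathcomp Require Import all_boot all_order all_algebra.
From mathcomp Require Import complex.
From mathcomp Require Import reals.

Set Implicit Arguments.
Unset Strict Implicit.
Unset Printing Implicit Defensive.

Import Order.TTheory GRing.Theory Num.Theory.
Local Open Scope ring_scope.

(* Vectors are column vectors, whereas [diag_mx] takes a row vector. *)
Definition D (R : realType) (m : nat) (x : 'cV[R]_m) : 'M[R]_m :=
  diag_mx x^T.

Definition hadamard (R : realType) (m n : nat) (A B : 'M[R]_(m, n)) :
  'M[R]_(m, n) := map2_mx *%R A B.

Definition ones (R : realType) (m : nat) : 'cV[R]_m := const_mx 1.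
Arguments ones {R m}.

Definition strictly_positive (R : realType) (m : nat) (x : 'cV[R]_m) : Prop :=
  forall i, 0 < x i 0.

Definition stochastic (R : realType) (m : nat) (P : 'M[R]_m) : Prop :=
  (forall i j, 0 <= P i j) /\ (forall i, \sum_j P i j = 1).

Definition probability_vector (R : realType) (m : nat) (mu : 'cV[R]_m) : Prop :=
  (forall i, 0 <= mu i 0) /\ \sum_i mu i 0 = 1.

Definition stationary (R : realType) (m : nat) (P : 'M[R]_m) (mu : 'cV[R]_m) :
  Prop :=
  [/\ probability_vector mu, mu^T *m P = mu^T & D mu \in unitmx].

(* A reducible stochastic matrix has several stationary distributions, so the
   distribution is a parameter of reversibility and not a function of [P]. *)
Definition reversible_wrt (R : realType) (m : nat) (P : 'M[R]_m)
  (mu : 'cV[R]_m) : Prop :=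
  [/\ stochastic P, stationary P mu & P = invmx (D mu) *m P^T *m D mu].

Definition reversible (R : realType) (m : nat) (P : 'M[R]_m) : Prop :=
  exists mu : 'cV[R]_m, reversible_wrt P mu.

Definition tilted (R : realType) (m : nat) (u : 'cV[R]_m) (A : 'M[R]_m) :
  'M[R]_m := invmx (D (A *m u)) *m A *m D u.

Definition positive_semidefinite (R : realType) (m : nat) (S : 'M[R]_m) : Prop :=
  S \is symmetricmx /\ forall x : 'cV[R]_m, 0 <= (x^T *m S *m x) 0 0.

Definition complex_mx (R : realType) (m : nat) (A : 'M[R]_m) : 'M[R[i]%C]_m :=
  map_mx (real_complex R) A.

(* Main.v *)
(** Detailed balance, [D(muP) P = P^T D(muP)], gives [D(d) W = B^T E B] with
    [d = Pu o muP o v], [B = P D(v)] and [E] the positive diagonal matrix with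
    entries [muP_k u_k / (Pv)_k]. The right-hand side is symmetric, so [W] is in
    detailed balance with [d]. Conjugating [W] by [D(d)^(1/2)] turns it into the
    Gram matrix [C^T C] of [C = E^(1/2) B D(d)^(-1/2)]. *)

Require Import Defs.
From HB Require Import structures.
From mathcomp Require Import all_boot all_order all_algebra.
From mathcomp Require Import complex.
From mathcomp Require Import reals ring.

Set Implicit Arguments.
Unset Strict Implicit.
Unset Printing Implicit Defensive.

Import Order.TTheory GRing.Theory Num.Theory.
Local Open Scope ring_scope.

Section Gram.
Variables (C : numClosedFieldType).

Lemma dotC_ge0 n (w : 'rV[C]_n) : 0 <= (w *m map_mx Num.conj w^T) 0 0.
Proof. by rewrite mxE sumr_ge0 // => i _; rewrite !mxE mul_conjC_ge0. Qed.

Lemma dotC_gt0 n (w : 'rV[C]_n) : w != 0 -> 0 < (w *m map_mx Num.conj w^T) 0 0.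
Proof.
move=> w0; rewrite lt0r dotC_ge0 andbT; apply: contraNneq w0.
rewrite mxE => /psumr_eq0P H; apply/eqP/rowP => i; rewrite mxE; apply/eqP.
rewrite -mul_conjC_eq0; apply/eqP; have := H _ i isT; rewrite !mxE; apply.
by move=> j _; rewrite !mxE mul_conjC_ge0.
Qed.

(** Eigenvectors are rows: multiplying [w B^H B = lam w] on the right by [w^H] gives
    [|w B^H|^2 = lam |w|^2], and [|w|^2 > 0]. *)
Lemma gram_eigenvalue_ge0 m n (B : 'M[C]_(n, m)) (lam : C) :
  eigenvalue (map_mx Num.conj B^T *m B) lam -> 0 <= lam.
Proof.
case/eigenvalueP => w wE w0.
rewrite -(pmulr_lge0 _ (dotC_gt0 w0)).
have -> : lam * (w *m map_mx Num.conj w^T) 0 0 =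
          ((lam *: w) *m map_mx Num.conj w^T) 0 0
  by rewrite -scalemxAl [RHS]mxE.
rewrite -wE.
have -> : w *m (map_mx Num.conj B^T *m B) *m map_mx Num.conj w^T =
    (w *m map_mx Num.conj B^T) *m map_mx Num.conj (w *m map_mx Num.conj B^T)^T.
  rewrite trmx_mul map_mxM !mulmxA; congr (_ *m _ *m _).
  by apply/matrixP => i j; rewrite !mxE /= conjCK.
exact: dotC_ge0.
Qed.

End Gram.

Section Real.
Variables (R : realType) (m : nat).
Implicit Types (x d : 'cV[R]_m) (A P B : 'M[R]_m).

Lemma gram_psd B : positive_semidefinite (B^T *m B).
Proof.
split=> [|x].
  by apply/is_hermitianmxP; rewrite expr0 scale1r map_mx_id // trmx_mul trmxK.
rewrite mulmxA -mulmxA -trmx_mul mxE sumr_ge0 // => i _.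
by rewrite mxE -expr2 sqr_ge0.
Qed.

Lemma similar_gram_eigenvalue A B (p : 'M[R]_m) (lam : R[i]%C) :
  p \in unitmx -> p *m A = B^T *m B *m p -> eigenvalue (complex_mx A) lam ->
  exists2 r : R, 0 <= r & lam = real_complex R r.
Proof.
move=> pu pA; have -> : A = invmx p *m (B^T *m B) *m p.
  by rewrite -mulmxA -pA mulKmx.
rewrite /complex_mx !map_mxM map_invmx.
set q := map_mx _ p; have qu : q \in unitmx by rewrite map_unitmx.
case/eigenvalueP => w wE w0.
(* In the partial order of [R[i]], [0 <= lam] already contains [Im lam = 0], so this one inequality
   yields both reality and sign. *)
suff : 0 <= lam.
  rewrite lecE /= => /andP[/eqP im0 re0]; exists (complex.Re lam) => //.
  by case: lam im0 {re0 wE} => a b /= ->.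
apply: (@gram_eigenvalue_ge0 _ _ _ (map_mx (real_complex R) B)).
have -> : map_mx Num.conj (map_mx (real_complex R) B)^T
          = map_mx (real_complex R) B^T.
  apply/matrixP => i j; rewrite !mxE; apply/eqP.
  by rewrite eq_complex /= oppr0 !eqxx.
(* A row eigenvector [w] of [q^-1 G q] turns into the row eigenvector [w q^-1] of [G]. *)
apply/eigenvalueP; exists (w *m invmx q).
  by rewrite scalemxAl -wE !mulmxA mulmxK.
by apply: contraNneq w0 => w0; rewrite -(mulmxKV qu w) w0 mul0mx.
Qed.

Lemma D_unit x : (D x \in unitmx) = [forall i, x i 0 != 0].
Proof.
rewrite unitmxE det_diag unitfE prodf_seq_neq0.
apply/allP/forallP => [H i|H i _]; last by rewrite mxE H.
by have := H i (mem_index_enum _); rewrite mxE.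
Qed.

Lemma D_unit_pos x : strictly_positive x -> D x \in unitmx.
Proof. by move=> x0; rewrite D_unit; apply/forallP => i; rewrite gt_eqF. Qed.

Lemma stochastic_mul A B : stochastic A -> stochastic B -> stochastic (A *m B).
Proof.
move=> [A0 A1] [B0 B1]; split=> [i j|i].
  by rewrite mxE sumr_ge0 // => k _; rewrite mulr_ge0.
under eq_bigr => j _ do rewrite mxE.
rewrite exchange_big /= -(A1 i); apply: eq_bigr => k _.
by rewrite -mulr_sumr B1 mulr1.
Qed.

(** Invertibility of [D d] upgrades the non-negative entries of [d] to positive ones; clearing the
    inverse in the matrix identity leaves the entrywise balance. *)
Lemma detailed_balance P d : reversible_wrt P d ->
  strictly_positive d /\ forall i j, d i 0 * P i j = d j 0 * P j i.
Proof.
move=> [_ [[d0 _] _ Du] PE]; split=> [i|i j].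
  by move: Du; rewrite D_unit lt0r d0 andbT => /forallP.
have : D d *m P = P^T *m D d by rewrite {1}PE -mulmxA mulKVmx.
rewrite mul_diag_mx mul_mx_diag => /matrixP/(_ i j).
by rewrite !mxE => ->; rewrite mulrC.
Qed.

(** A converse in which [d] need not be normalised. Summing the balance over [i] turns column [j] of
    [P] into row [j], whose sum is 1; this is stationarity. *)
Lemma reversible_balance P d : (0 < m)%N -> stochastic P -> strictly_positive d ->
  (forall i j, d i 0 * P i j = d j 0 * P j i) ->
  reversible_wrt P ((\sum_i d i 0)^-1 *: d).
Proof.
move=> m0 sP d0 PE; set c := (\sum_i _)^-1.
have s0 : 0 < \sum_i d i 0.
  rewrite (bigD1 (Ordinal m0)) //= ltr_pwDl ?d0 // sumr_ge0 // => i _.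
  exact: ltW.
have c0 : 0 < c by rewrite invr_gt0.
have cd0 : strictly_positive (c *: d) by move=> i; rewrite mxE mulr_gt0.
have Du := D_unit_pos cd0.
split=> //; first split=> //.
- split=> [i|]; first exact: ltW.
  under eq_bigr => i _ do rewrite mxE.
  by rewrite -mulr_sumr mulVf // gt_eqF.
- apply/rowP => j; rewrite !mxE.
  under eq_bigr => i _ do rewrite !mxE -mulrA PE mulrA.
  by rewrite -mulr_sumr (proj2 sP) mulr1.
- rewrite -mulmxA; apply: (canRL (mulKmx Du)).
  rewrite mul_diag_mx mul_mx_diag; apply/matrixP => i j; rewrite !mxE.
  by rewrite -mulrA PE mulrA mulrC.
Qed.

Lemma stochastic_mul_pos P x : stochastic P -> strictly_positive x ->
  strictly_positive (P *m x).
Proof.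
move=> [P0 P1] x0 i; rewrite mxE lt0r sumr_ge0 ?andbT; last first.
  by move=> j _; rewrite mulr_ge0 // ltW.
(* If [(P x)_i] vanished, so would each term [P_ij x_j], hence the whole row [i], whose sum is 1. *)
apply/eqP => /psumr_eq0P H; have := oner_neq0 R; rewrite -(P1 i) big1 ?eqxx //.
move=> j _; apply/eqP; have /eqP : P i j * x j 0 = 0.
  by apply: H => // k _; rewrite mulr_ge0 // ltW.
by rewrite mulf_eq0 (gt_eqF (x0 j)) orbF.
Qed.

Lemma tiltedE x A i j : strictly_positive (A *m x) ->
  tilted x A i j = A i j * x j 0 / (A *m x) i 0.
Proof.
move=> Ax0; have Au := D_unit_pos Ax0.
have : D (A *m x) *m tilted x A = A *m D x by rewrite /tilted -mulmxA mulKVmx.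
rewrite mul_diag_mx mul_mx_diag => /matrixP/(_ i j); rewrite [LHS]mxE [RHS]mxE.
rewrite [in LHS]mxE [x^T 0 j]mxE => <-; rewrite mulrC mulKf // gt_eqF //.
Qed.

Lemma tilted_stochastic P x : stochastic P -> strictly_positive x ->
  stochastic (tilted x P).
Proof.
move=> sP x0; have Px0 := stochastic_mul_pos sP x0; split=> [i j|i].
  by rewrite tiltedE // divr_ge0 ?mulr_ge0 ?(proj1 sP) // ltW.
under eq_bigr => j _ do rewrite tiltedE //.
rewrite -mulr_suml.
have <- : (P *m x) i 0 = \sum_j P i j * x j 0 by rewrite mxE.
by rewrite mulfV // gt_eqF.
Qed.

Lemma tilted_reversible P mu x : (0 < m)%N -> reversible_wrt P mu ->
  strictly_positive x -> reversible (tilted x P).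
Proof.
move=> m0 rP x0; have [mu0 PE] := detailed_balance rP.
case: rP => sP _ _; have Px0 := stochastic_mul_pos sP x0.
(* The factor [(P x)_i] cancels the row normaliser of the tilt, leaving [mu_i P_ij x_i x_j], which
   is symmetric by the balance of [P]. *)
eexists; apply: (@reversible_balance _ (\col_i ((P *m x) i 0 * mu i 0 * x i 0))).
- by [].
- exact: tilted_stochastic.
- by move=> i; rewrite mxE !mulr_gt0.
move=> i j; rewrite !tiltedE // ![(\col__ _) _ _]mxE.
have Pi := lt0r_neq0 (Px0 i); have Pj := lt0r_neq0 (Px0 j).
rewrite [LHS](_ : _ = (mu i 0 * P i j) * (x i 0 * x j 0)); last by field.
by rewrite PE; field.
Qed.

(** The entrywise form of [D(d) W = B^T E B]: [(P u)_i] cancels the normaliser of the first tilt,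
    and balance replaces [mu_i P_ik] by [mu_k P_ki]. Both the reversibility of [W] and its Gram form
    rest on it. *)
Lemma tilted_mulE P mu u v i j : reversible_wrt P mu ->
  strictly_positive u -> strictly_positive v ->
  (P *m u) i 0 * mu i 0 * v i 0 * (tilted u P *m tilted v P) i j =
  \sum_k mu k 0 * u k 0 / (P *m v) k 0 * (P k i * v i 0) * (P k j * v j 0).
Proof.
move=> rP u0 v0; have [mu0 PE] := detailed_balance rP.
case: rP => sP _ _; have Pu0 := stochastic_mul_pos sP u0.
have Pv0 := stochastic_mul_pos sP v0.
rewrite [(tilted u P *m _) i j]mxE mulr_sumr; apply: eq_bigr => k _.
rewrite !tiltedE //.
have Pi := lt0r_neq0 (Pu0 i); have Pk := lt0r_neq0 (Pv0 k).
transitivity ((mu i 0 * P i k) * (v i 0 * u k 0 * P k j * v j 0 / (P *m v) k 0)).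
  by field; rewrite Pi Pk.
by rewrite PE; field.
Qed.

End Real.

Theorem proposition5 (R : realType) (m : nat) (u v : 'cV[R]_m)
    (P : 'M[R]_m) (muP : 'cV[R]_m)
    (hu : strictly_positive u) (hv : strictly_positive v)
    (hP : reversible_wrt P muP) :
  let V := tilted v P in
  let U := tilted u P in
  let W := U *m V in
  let alpha :=
    ((ones^T *m D (P *m u) *m D muP *m D v *m ones) 0 0)^-1 in
  let muW := alpha *: hadamard (hadamard (P *m u) muP) v in
  [/\ reversible V,
      reversible U,
      reversible_wrt W muW,
      exists2 S : 'M[R]_m, positive_semidefinite S & similar_in unitmx W S
    & forall lam : R[i]%C, eigenvalue (complex_mx W) lam ->
        exists2 r : R, 0 <= r & lam = real_complex R r].
Proof.
move=> V U W alpha muW.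
have [mu0 PE] := detailed_balance hP.
have [sP [[_ mu1] _ _] _] := hP.
(* In dimension 0 the entries of [muP] would sum to 0 instead of 1. *)
have m0 : (0 < m)%N.
  case: (posnP m) => // mE; move: mu1; rewrite big1 => [|[i im]].
    by move/eqP; rewrite eq_sym oner_eq0.
  by exfalso; rewrite mE in im.
have Pu0 := stochastic_mul_pos sP hu; have Pv0 := stochastic_mul_pos sP hv.
pose d : 'cV[R]_m := hadamard (hadamard (P *m u) muP) v.
have dE i : d i 0 = (P *m u) i 0 * muP i 0 * v i 0.
  by rewrite /d /hadamard [LHS]mxE [map2_mx _ _ _ i 0]mxE.
have d0 : strictly_positive d by move=> i; rewrite dE !mulr_gt0.
have WE i j := tilted_mulE i j hP hu hv.
(* [p] is [D(d)^(1/2)], and the matrix [B] below is [E^(1/2) P D(v) D(d)^(-1/2)], that is, the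
   factor called [C] in the outline. *)
pose p : 'M[R]_m := D (\col_i Num.sqrt (d i 0)).
pose B : 'M[R]_m := \matrix_(k, j) (Num.sqrt (muP k 0 * u k 0 / (P *m v) k 0)
                       * (P k j * v j 0) / Num.sqrt (d j 0)).
have pu : p \in unitmx.
  by apply: D_unit_pos => i; rewrite mxE sqrtr_gt0.
have pW : p *m W = B^T *m B *m p.
  rewrite mul_diag_mx mul_mx_diag; apply/matrixP => i j; rewrite ![LHS]mxE [RHS]mxE.
  rewrite [(B^T *m B) i j]mxE ![(\col__ _)^T _ _]mxE ![(\col__ _) _ _]mxE.
  have si : Num.sqrt (d i 0) != 0 by rewrite gt_eqF // sqrtr_gt0.
  have sj : Num.sqrt (d j 0) != 0 by rewrite gt_eqF // sqrtr_gt0.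
  (* A second factor [sqrt d_i] makes the left side [d_i W_ij], so that [tilted_mulE] applies. *)
  apply: (mulfI si); rewrite mulrA -expr2 sqr_sqrtr ?ltW // {1}dE WE.
  rewrite mulr_suml mulr_sumr; apply: eq_bigr => k _.
  rewrite [B^T _ _]mxE ![B _ _]mxE.
  (* The weight [E_k] is split into two square roots, one for [B^T] and one for [B]. *)
  rewrite -[X in X * _ * _](@sqr_sqrtr _ (muP k 0 * u k 0 / (P *m v) k 0)).
    by field; rewrite si sj.
  by rewrite divr_ge0 ?mulr_ge0 // ltW.
split.
- exact: tilted_reversible m0 hP _.
- exact: tilted_reversible m0 hP _.
(* The product of diagonal matrices between the two all-ones vectors sums the entries of [d], so
   [alpha] is the normaliser of [reversible_balance]. *)
- have aE : alpha = (\sum_i d i 0)^-1.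
    rewrite /alpha; congr (_^-1); rewrite [LHS]mxE; apply: eq_bigr => i _.
    by rewrite /D !mul_mx_diag !mxE mul1r mulr1.
  rewrite /muW aE; apply: reversible_balance => //.
    by apply: stochastic_mul; apply: tilted_stochastic.
  (* Each term of the sum is symmetric in [i] and [j]. *)
  move=> i j; rewrite !dE !WE; apply: eq_bigr => k _.
  by rewrite mulrAC.
- exists (B^T *m B); first exact: gram_psd.
  by exists p => //; apply/similarP.
- by move=> lam; apply: similar_gram_eigenvalue pu pW.
Qed.
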